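(* Let $\lambda>0$. Suppose that $n$ is an integer with $1\le n\le q$ such that $F_i(x,y)\equiv0$ and $G_i(x,y)\equiv 0$ for all $i<n$. Let $x_\ast(t),y_\ast(t)$ be the solution of the perturbed system $$\frac{dx}{dt}=\partial_y H(x,y;\lambda)+F(x,y,t),\qquad \frac{dy}{dt}=-\partial_x H(x,y;\lambda)+G(x,y,t)$$ with asymptotics $$x_\ast(t)=\sigma+\sum_{k=1}^{\infty}t^{-\frac kq}x_k,\qquad y_\ast(t)=\sum_{k=1}^{\infty}t^{-\frac kq}y_k,\qquad t\to\infty,$$ where $\sigma=-\sqrt\lambda$ and $x_k,y_k$ are real constants. Then the solution $x_\ast(t),y_\ast(t)$ is unstable.
   Context: Standing setting. The functions $H(x,y;\lambda)$, $F(x,y,t)$, $G(x,y,t)$ are smooth for all $(x,y)\in\mathbb R^2$, $t>0$, $\lambda\in\mathbb R$. The Hamiltonian of the limiting system is $H(x,y;\lambda)=\frac{y^2}{2}+V(x;\lambda)$ with $\partial_xV(x;\lambda)=(x^2-\lambda)w(x)$, where, for some $d_0>0$, $w(x)>0$ for all $(x,\lambda)\in\{|x|<\sqrt\lambda+d_0,\ \lambda\ge 0\}\cup\{|x|<d_0,\ \lambda<0\}$. The perturbations satisfy $F(x,y,t)\to0$ and $G(x,y,t)\to0$ as $t\to\infty$ for $(x,y)$ in any compact subset of $\mathbb R^2$, and have power-law asymptotics $$F(x,y,t)=\sum_{k=1}^\infty t^{-\frac kq}F_k(x,y),\qquad G(x,y,t)=\sum_{k=1}^\infty t^{-\frac kq}G_k(x,y),\qquad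 t\to\infty,$$ where $q$ is a positive integer and $F_k,G_k$ are smooth functions on $\mathbb R^2$. Infinite series followed by ''$t\to\infty$'' are understood as asymptotic expansions. The coefficients $x_k,y_k$ of the solution's expansion are those obtained by substituting the series into the system and equating the coefficients of equal powers of $t$. Stability and instability of a solution are understood in the sense of Lyapunov, as $t\to\infty$.
   Formalization: The expansions of F and G are assumed uniform on compact sets and termwise differentiable once in x and y; without this the claim fails, e.g. V=x^3/3-λx, F=-e^{-t}tanh(e^{3t}(x+√λ)), G=-e^{-t}tanh(e^{3t}y), all F_k=G_k=0. *)

(* Defs.v *)
(* Stdlib reals with Coquelicot. *)
From Stdlib Require Import Reals.
From Coquelicot Require Import Coquelicot.
Open Scope R_scope.

Definition partial1 (f : R -> R -> R -> R) : R -> R -> R -> R :=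
  fun x y z => Derive (fun s => f s y z) x.
Definition partial2 (f : R -> R -> R -> R) : R -> R -> R -> R :=
  fun x y z => Derive (fun s => f x s z) y.
Definition partial3 (f : R -> R -> R -> R) : R -> R -> R -> R :=
  fun x y z => Derive (fun s => f x y s) z.

(* Three-variable analogue of Coquelicot's [ex_diff_n].  [Derive] is total, so
   for a domain-restricted [f] this is meaningful only when required at every
   point of an open set, as in [smooth_on3]. *)
Fixpoint ex_diff_n3 (f : R -> R -> R -> R) (m : nat) (x y z : R) : Prop :=
  continuous (fun p : R * R * R => f (fst (fst p)) (snd (fst p)) (snd p))
    (x, y, z) /\
  match m with
  | O => True
  | S m' =>
      ex_derive (fun s => f s y z) x /\
      ex_derive (fun s => f x s z) y /\
      ex_derive (fun s => f x y s) z /\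
      ex_diff_n3 (partial1 f) m' x y z /\
      ex_diff_n3 (partial2 f) m' x y z /\
      ex_diff_n3 (partial3 f) m' x y z
  end.

Definition smooth_on3 (U : R -> R -> R -> Prop) (f : R -> R -> R -> R) : Prop :=
  forall (m : nat) (x y z : R), U x y z -> ex_diff_n3 f m x y z.

Definition smooth2 (f : R -> R -> R) : Prop :=
  forall (m : nat) (x y : R), ex_diff_n f m x y.

(* [E x y t -> 0] as [t -> +oo], uniformly for [(x, y)] in compact subsets of
   the plane; the closed squares are cofinal among those. *)
Definition vanishes_loc_unif (E : R -> R -> R -> R) : Prop :=
  forall (M : R) (eps : posreal),
    Rbar_locally p_infty (fun t =>
      forall x y : R, Rabs x <= M -> Rabs y <= M -> Rabs (E x y t) < eps).

(* [t^(-k/q)], for [t > 0] *)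
Definition tpow (q k : nat) (t : R) : R := Rpower t (- (INR k / INR q)).

(* [f(t) = c_0 + sum_{k>=1} t^(-k/q) c_k] as a Poincare asymptotic expansion:
   the remainder after the term of index [N] is [o(t^(-N/q))].  The value
   [c 0] is never used. *)
Definition power_expansion (q : nat) (f : R -> R) (c0 : R) (c : nat -> R)
  : Prop :=
  forall N : nat,
    is_lim (fun t =>
      (f t - (c0 + sum_n_m (fun k => tpow q k t * c k) 1 N)) / tpow q N t)
      p_infty 0.

(* The same for [F(x,y,t) = sum_{k>=1} t^(-k/q) F_k(x,y)], locally uniformly
   in [(x, y)]. *)
Definition power_expansion_loc_unif (q : nat)
  (F : R -> R -> R -> R) (Fk : nat -> R -> R -> R) : Prop :=
  forall N : nat,
    vanishes_loc_unif (fun x y t =>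
      (F x y t - sum_n_m (fun k => tpow q k t * Fk k x y) 1 N) / tpow q N t).

(* The expansion may be differentiated termwise once in [x] and in [y].
   Without this the remainder could have unbounded [(x, y)]-derivatives, e.g.
   [F = - exp (-t) * tanh (exp (3t) * (x - x0))] with all [F_k = 0], and the
   expansion would say nothing about the linearization along a solution. *)
Definition power_expansion_C1 (q : nat)
  (F : R -> R -> R -> R) (Fk : nat -> R -> R -> R) : Prop :=
  power_expansion_loc_unif q F Fk /\
  power_expansion_loc_unif q (partial1 F)
    (fun k x y => Derive (fun s => Fk k s y) x) /\
  power_expansion_loc_unif q (partial2 F)
    (fun k x y => Derive (fun s => Fk k x s) y).

(* [(x, y)] solves [x' = f(x,y,t)], [y' = g(x,y,t)] on [[s, +oo)].  The
   derivative at [s] is two-sided; as the values before [s] are unconstrained,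
   this amounts to a one-sided derivative there. *)
Definition solution_from (f g : R -> R -> R -> R) (s : R) (x y : R -> R)
  : Prop :=
  forall t : R, s <= t ->
    is_derive x t (f (x t) (y t) t) /\ is_derive y t (g (x t) (y t) t).

(* Lyapunov stability, as [t -> +oo], of a solution [(xs, ys)] on
   [[t0, +oo)]: for every initial time [s], the solutions starting close enough
   to [(xs s, ys s)] exist for all [t >= s] and remain close.  For vector
   fields that are smooth for positive time, the solution with given initial
   data is unique, so the existential over [x], [y] denotes that solution. *)
Definition lyapunov_stable (f g : R -> R -> R -> R) (t0 : R) (xs ys : R -> R)
  : Prop :=
  forall (s : R) (eps : posreal), t0 <= s ->
    exists delta : posreal,
      forall a b : R,
        Rabs (a - xs s) < delta -> Rabs (b - ys s) < delta ->
        exists x y : R -> R,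
          x s = a /\ y s = b /\ solution_from f g s x y /\
          forall t : R, s <= t ->
            Rabs (x t - xs t) < eps /\ Rabs (y t - ys t) < eps.

Definition lyapunov_unstable (f g : R -> R -> R -> R) (t0 : R)
  (xs ys : R -> R) : Prop :=
  ~ lyapunov_stable f g t0 xs ys.

(* The right-hand sides of [x' = H_y + F], [y' = - H_x + G]; the third argument
   of [H] is the parameter [lam]. *)
Definition rhs_x (H F : R -> R -> R -> R) (lam : R) : R -> R -> R -> R :=
  fun x y t => partial2 H x y lam + F x y t.
Definition rhs_y (H G : R -> R -> R -> R) (lam : R) : R -> R -> R -> R :=
  fun x y t => - partial1 H x y lam + G x y t.

(* Main.v *)
Require Import Defs.
From Stdlib Require Import Reals Lra Lia.
From Coquelicot Require Import Coquelicot.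
Open Scope R_scope.

(** Near the saddle [(-sqrt lam, 0)] the linear part of the limiting system is
    [u' = v], [v' = kappa u] with
    [kappa = - V''(-sqrt lam) = 2 sqrt lam w(-sqrt lam) > 0].  Its trajectories
    expand the product of the coordinates:
    [(u v)' = v^2 + kappa u^2 >= 2 c (u^2 + v^2)], where
    [c = Rmin 1 kappa / 2].

    Let now [(u, v)] be the difference of a nearby solution and [(xs, ys)].
    It satisfies the linear system up to three errors: the variation of [V'']
    between [-sqrt lam] and the two solutions, and the increments of [F] and of
    [G].  Since [xs] tends to [-sqrt lam] and [ys] to [0], and since the first
    [(x, y)]-derivatives of [F] and [G] tend to zero locally uniformly, the
    mean value theorem bounds all of them by an arbitrarily small multiple of
    [|u| + |v|] at late times.  So [(u v)' >= c (u^2 + v^2) >= 2 c u v] still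
    holds while [(u, v)] is small ([increment_form_coercive] and
    [saddle_increment]).  A solution issued from [u = v > 0], however small,
    has [u v] growing exponentially, and hence leaves every fixed small
    neighbourhood ([product_expansion_unstable]). *)

(** * Instability from an expanding product *)

Lemma exponential_growth (W dW : R -> R) (k s : R) :
  (forall t, s <= t -> is_derive W t (dW t)) ->
  (forall t, s <= t -> k * W t <= dW t) ->
  forall t, s <= t -> W s * exp (k * (t - s)) <= W t.
Proof.
intros HW Hk t Hst.
set (Z := fun r => W r * exp (- k * (r - s))).
assert (HZ : forall r, s <= r ->
  is_derive Z r ((dW r - k * W r) * exp (- k * (r - s)))).
{ intros r Hr; unfold Z.
  assert (D := HW r Hr).
  auto_derive; [now exists (dW r)|].
  rewrite (is_derive_unique (fun x : R => W x) r _ D); unfold Rminus; ring. }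
assert (Hmono : Z s <= Z t).
{ destruct (MVT_gen Z s t
    (fun r => (dW r - k * W r) * exp (- k * (r - s)))) as [r [Hr E]];
    rewrite Rmin_left, Rmax_right in * by lra.
  - intros r Hr; apply HZ; lra.
  - intros r Hr; apply continuity_pt_filterlim.
    apply (ex_derive_continuous Z r); eexists; apply HZ; lra.
  - assert (0 <= (dW r - k * W r) * exp (- k * (r - s)) * (t - s)).
    { repeat apply Rmult_le_pos; try lra.
      - specialize (Hk r); lra.
      - left; apply exp_pos. }
    lra. }
unfold Z in Hmono.
replace (- k * (s - s)) with 0 in Hmono by ring.
rewrite exp_0, Rmult_1_r in Hmono.
replace (W t) with (W t * exp (- k * (t - s)) * exp (k * (t - s))).
- apply Rmult_le_compat_r; [left; apply exp_pos | exact Hmono].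
- rewrite Rmult_assoc, <- exp_plus.
  replace (- k * (t - s) + k * (t - s)) with 0 by ring.
  rewrite exp_0; ring.
Qed.

(** Chetaev's criterion with the product [u v] of the components of the
    difference of two solutions.  As [(u v)' >= c (u^2 + v^2) >= 2 c u v],
    the product grows exponentially once it is positive, as it is for
    [u = v = delta / 2]; it would exceed the bound [eps^2] that stability
    imposes on it. *)
Lemma product_expansion_unstable (f g : R -> R -> R -> R) (t0 s : R)
  (xs ys : R -> R) (c : R) (eps : posreal) :
  solution_from f g t0 xs ys -> t0 <= s -> 0 < c ->
  (forall t x y, s <= t -> Rabs (x - xs t) < eps -> Rabs (y - ys t) < eps ->
     c * ((x - xs t) ^ 2 + (y - ys t) ^ 2) <=
     (y - ys t) * (f x y t - f (xs t) (ys t) t) +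
     (x - xs t) * (g x y t - g (xs t) (ys t) t)) ->
  lyapunov_unstable f g t0 xs ys.
Proof.
intros sol Hs Hc Hexp Hstab.
destruct (Hstab s eps Hs) as [[del Hdel] Hd]; simpl in Hd.
destruct (Hd (xs s + del / 2) (ys s + del / 2))
  as (x & y & Hx & Hy & Hsol & Hclose).
{ replace (_ - _) with (del / 2) by ring; rewrite Rabs_pos_eq; lra. }
{ replace (_ - _) with (del / 2) by ring; rewrite Rabs_pos_eq; lra. }
set (W := fun t => (x t - xs t) * (y t - ys t)).
set (dW := fun t =>
  (y t - ys t) * (f (x t) (y t) t - f (xs t) (ys t) t) +
  (x t - xs t) * (g (x t) (y t) t - g (xs t) (ys t) t)).
assert (HW : forall t, s <= t -> is_derive W t (dW t)).
{ intros t Ht.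
  destruct (Hsol t Ht) as [D1 D2].
  destruct (sol t) as [D3 D4]; [lra|].
  unfold W, dW.
  auto_derive; [repeat split; eexists; eassumption|].
  rewrite (is_derive_unique (fun r : R => x r) t _ D1),
    (is_derive_unique (fun r : R => y r) t _ D2),
    (is_derive_unique (fun r : R => xs r) t _ D3),
    (is_derive_unique (fun r : R => ys r) t _ D4).
  ring. }
assert (Hge : forall t, s <= t -> 2 * c * W t <= dW t).
{ intros t Ht.
  destruct (Hclose t Ht) as [C1 C2].
  apply Rle_trans with (2 := Hexp t (x t) (y t) Ht C1 C2).
  unfold W.
  assert (0 <= c * ((x t - xs t) - (y t - ys t)) ^ 2)
    by (apply Rmult_le_pos; [lra | apply pow2_ge_0]).
  lra. }
assert (HWs : W s = del / 2 * (del / 2)) by (unfold W; rewrite Hx, Hy; ring).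
assert (HWs0 : 0 < W s) by (rewrite HWs; apply Rmult_lt_0_compat; lra).
assert (Heps := cond_pos eps).
(* With [exp z > z], this is late enough for the lower bound on [u v] to
   reach [eps^2]. *)
set (z := eps * eps / W s).
assert (Hz : 0 < z) by (apply Rdiv_lt_0_compat; nra).
set (t := s + z / (2 * c)).
assert (Hz2 : 0 < z / (2 * c)) by (apply Rdiv_lt_0_compat; lra).
assert (Ht : s <= t) by (unfold t; lra).
assert (Hgrow := exponential_growth W dW (2 * c) s HW Hge t Ht).
replace (2 * c * (t - s)) with z in Hgrow by (unfold t; field; lra).
assert (Hez := exp_ineq1 z ltac:(lra)).
assert (HWt : W t <= eps * eps).
{ destruct (Hclose t Ht) as [C1 C2].
  apply Rle_trans with (1 := Rle_abs _).
  unfold W; rewrite Rabs_mult.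
  apply Rmult_le_compat; try apply Rabs_pos; lra. }
assert (Hzw : W s * z = eps * eps) by (unfold z; field; lra).
nra.
Qed.

(** * Mean value estimates *)

Lemma linear_approx_of_derive (h : R -> R) (l r k eta a b : R) :
  (forall x, l <= x <= r -> ex_derive h x /\ Rabs (Derive h x - k) <= eta) ->
  l <= a <= r -> l <= b <= r ->
  Rabs (h b - h a - k * (b - a)) <= eta * Rabs (b - a).
Proof.
intros Hh Ha Hb.
assert (Hin : forall x, Rmin a b <= x <= Rmax a b -> l <= x <= r).
{ intros x Hx; unfold Rmin, Rmax in Hx; destruct (Rle_dec a b); lra. }
destruct (MVT_gen h a b (Derive h)) as [x [Hx E]].
- intros x Hx; apply Derive_correct, Hh, Hin; lra.
- intros x Hx; apply continuity_pt_filterlim, (ex_derive_continuous h x).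
  now apply Hh, Hin.
- rewrite E, <- Rmult_minus_distr_r, Rabs_mult.
  apply Rmult_le_compat_r; [apply Rabs_pos | now apply Hh, Hin].
Qed.

Lemma increment_of_partials (E : R -> R -> R -> R) (M eta t : R) :
  (forall x y, ex_derive (fun s => E s y t) x) ->
  (forall x y, ex_derive (fun s => E x s t) y) ->
  (forall x y, Rabs x <= M -> Rabs y <= M -> Rabs (partial1 E x y t) <= eta) ->
  (forall x y, Rabs x <= M -> Rabs y <= M -> Rabs (partial2 E x y t) <= eta) ->
  forall x y x' y',
    Rabs x <= M -> Rabs y <= M -> Rabs x' <= M -> Rabs y' <= M ->
    Rabs (E x y t - E x' y' t) <= eta * (Rabs (x - x') + Rabs (y - y')).
Proof.
intros D1 D2 B1 B2 x y x' y' Hx Hy Hx' Hy'.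
assert (I1 := linear_approx_of_derive (fun s => E s y t) (- M) M 0 eta x' x).
assert (I2 := linear_approx_of_derive (fun s => E x' s t) (- M) M 0 eta y' y).
apply Rabs_le_between in Hy'.
assert (Hy0 := proj1 (Rabs_le_between _ _) Hy).
assert (Hx0 := proj1 (Rabs_le_between _ _) Hx).
assert (Hx'0 := proj1 (Rabs_le_between _ _) Hx').
specialize (I1 ltac:(intros r Hr; split; [apply D1|];
  rewrite Rminus_0_r; apply B1; [now apply Rabs_le | exact Hy]) Hx'0 Hx0).
specialize (I2 ltac:(intros r Hr; split; [apply D2|];
  rewrite Rminus_0_r; apply B2; [exact Hx' | now apply Rabs_le]) Hy' Hy0).
cbv beta in I1, I2.
rewrite Rmult_0_l, Rminus_0_r in I1, I2.
replace (E x y t - E x' y' t)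
  with ((E x y t - E x' y t) + (E x' y t - E x' y' t)) by ring.
apply Rle_trans with (1 := Rabs_triang _ _); lra.
Qed.

(** * Reading off the leading terms of the expansions *)

Lemma tpow_0 (q : nat) (t : R) : tpow q 0 t = 1.
Proof.
unfold tpow, Rpower; simpl INR; unfold Rdiv.
rewrite Rmult_0_l, Ropp_0, Rmult_0_l; apply exp_0.
Qed.

Lemma power_expansion_lim (q : nat) (f : R -> R) (c0 : R) (c : nat -> R) :
  power_expansion q f c0 c -> is_lim f p_infty c0.
Proof.
intros Hf; apply is_lim_spec; intros eps.
destruct (proj2 (is_lim_spec _ p_infty 0) (Hf 0%nat) eps) as [T HT].
exists T; intros t Ht; specialize (HT t Ht); cbv beta in HT.
rewrite tpow_0, sum_n_m_zero in HT by lia.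
unfold zero in HT; simpl in HT.
now replace (f t - c0) with ((f t - (c0 + 0)) / 1 - 0) by field.
Qed.

Lemma power_expansion_vanishes (q : nat) (F : R -> R -> R -> R)
  (Fk : nat -> R -> R -> R) :
  power_expansion_loc_unif q F Fk -> vanishes_loc_unif F.
Proof.
intros HF M eps.
destruct (HF 0%nat M eps) as [T HT].
exists T; intros t Ht x y Hx Hy; specialize (HT t Ht x y Hx Hy).
rewrite tpow_0, sum_n_m_zero in HT by lia.
unfold zero in HT; simpl in HT.
now replace (F x y t) with ((F x y t - 0) / 1) by field.
Qed.

(** The expansions of order zero of the two partial derivatives say that
    these tend to zero locally uniformly, so the Lipschitz constant of the
    perturbation in [(x, y)] does too. *)
Lemma expansion_increment (q : nat) (E : R -> R -> R -> R)
  (Ek : nat -> R -> R -> R) (M : R) (eta : posreal) :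
  smooth_on3 (fun _ _ t => 0 < t) E -> power_expansion_C1 q E Ek ->
  exists T, forall t, T < t -> forall x y x' y',
    Rabs x <= M -> Rabs y <= M -> Rabs x' <= M -> Rabs y' <= M ->
    Rabs (E x y t - E x' y' t) <= eta * (Rabs (x - x') + Rabs (y - y')).
Proof.
intros SE (_ & E1 & E2).
destruct (power_expansion_vanishes _ _ _ E1 M eta) as [T1 H1].
destruct (power_expansion_vanishes _ _ _ E2 M eta) as [T2 H2].
exists (Rmax 0 (Rmax T1 T2)); intros t Ht.
apply Rmax_Rlt in Ht as [Ht Ht']; apply Rmax_Rlt in Ht' as [Ht1 Ht2].
apply increment_of_partials.
- intros x y; apply (SE 1%nat x y t Ht).
- intros x y; apply (SE 1%nat x y t Ht).
- intros x y Hx Hy; left; now apply H1.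
- intros x y Hx Hy; left; now apply H2.
Qed.

(** * The linearization at the saddle *)

Section Hamiltonian.

Variables (H : R -> R -> R -> R) (V : R -> R -> R) (w : R -> R).
Hypothesis H_smooth : smooth_on3 (fun _ _ _ => True) H.
Hypothesis H_form : forall x y l : R, H x y l = y ^ 2 / 2 + V x l.
Hypothesis V_deriv : forall x l : R,
  is_derive (fun s => V s l) x ((x ^ 2 - l) * w x).

Lemma partial1_H (x y l : R) : partial1 H x y l = (x ^ 2 - l) * w x.
Proof.
unfold partial1.
rewrite (Derive_ext _ (fun s => y ^ 2 / 2 + V s l))
  by (intros; apply H_form).
apply is_derive_unique.
rewrite <- (Rplus_0_l (_ * _)).
apply (is_derive_plus (fun _ => y ^ 2 / 2) (fun s => V s l)).
- apply (is_derive_const (y ^ 2 / 2)).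
- apply V_deriv.
Qed.

Lemma partial2_H (x y l : R) : partial2 H x y l = y.
Proof.
unfold partial2.
rewrite (Derive_ext _ (fun s => s ^ 2 / 2 + V x l))
  by (intros; apply H_form).
apply is_derive_unique; auto_derive; [easy | field].
Qed.

Lemma ex_derive_force (x l : R) : ex_derive (fun s => (s ^ 2 - l) * w s) x.
Proof.
destruct (H_smooth 2%nat x 0 l I) as (_ & _ & _ & _ & H1 & _).
apply ex_derive_ext with (fun s => partial1 H s 0 l).
- intros s; apply partial1_H.
- apply H1.
Qed.

Lemma continuous_derive_force (x l : R) :
  continuous (Derive (fun s => (s ^ 2 - l) * w s)) x.
Proof.
destruct (H_smooth 2%nat x 0 l I) as (_ & _ & _ & _ & H1 & _).
destruct H1 as (_ & _ & _ & _ & H1 & _).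
destruct H1 as (H1 & _).
apply continuous_ext with (fun s => partial1 (partial1 H) s 0 l).
{ intros s; unfold partial1 at 1; apply Derive_ext; intros; apply partial1_H. }
apply (continuous_comp (fun s => (s, 0, l))
  (fun p : R * R * R => partial1 (partial1 H) (fst (fst p)) (snd (fst p)) (snd p))).
- apply (continuous_comp_2 (fun s : R => (s, 0)) (fun _ : R => l) pair).
  + apply (continuous_comp_2 (fun s : R => s) (fun _ : R => 0) pair).
    * apply continuous_id.
    * apply continuous_const.
    * apply continuous_ext with (fun p : R * R => p);
        [now intros [] | apply continuous_id].
  + apply continuous_const.
  + apply continuous_ext with (fun p : (R * R) * R => p);
        [now intros [] | apply continuous_id].
- exact H1.
Qed.

(** The force of parameter [-1] is [(x^2 + 1) w x], whose first factor never
    vanishes; so [w] inherits its regularity. *)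
Lemma ex_derive_w (x : R) : ex_derive w x.
Proof.
assert (E : forall s : R, (s ^ 2 - -1) * w s / (s ^ 2 - -1) = w s)
  by (intros s; field; nra).
apply (ex_derive_ext _ _ _ E).
apply (ex_derive_div (fun s => (s ^ 2 - -1) * w s) (fun s => s ^ 2 - -1)).
- apply ex_derive_force.
- now auto_derive.
- nra.
Qed.

Lemma Derive_force_zero (x l : R) : x ^ 2 = l ->
  Derive (fun s => (s ^ 2 - l) * w s) x = 2 * x * w x.
Proof.
intros Hx; apply is_derive_unique.
auto_derive; [apply ex_derive_w|].
rewrite <- Hx; simpl; ring.
Qed.

(** Continuity of [V''] turns the linearization at a zero [x0] of the force
    into an estimate for increments between any two points near [x0]. *)
Lemma saddle_increment (x0 l : R) (eta : posreal) : x0 ^ 2 = l ->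
  exists rho : posreal, forall x x',
    Rabs (x - x0) <= rho -> Rabs (x' - x0) <= rho ->
    Rabs ((x ^ 2 - l) * w x - (x' ^ 2 - l) * w x' - 2 * x0 * w x0 * (x - x'))
      <= eta * Rabs (x - x').
Proof.
intros Hx0.
destruct (proj1 (filterlim_locally _ _) (continuous_derive_force x0 l) eta)
  as [rho Hrho].
assert (Hr0 := cond_pos rho).
assert (Hr2 : 0 < rho / 2) by lra.
exists (mkposreal _ Hr2); simpl; intros x x' Hx Hx'.
apply Rabs_le_between in Hx; apply Rabs_le_between in Hx'.
apply (linear_approx_of_derive (fun s => (s ^ 2 - l) * w s)
  (x0 - rho / 2) (x0 + rho / 2)); [|lra|lra].
intros r Hr; split; [apply ex_derive_force|].
assert (B : ball x0 rho r).
{ unfold ball; simpl; unfold AbsRing_ball, abs, minus, plus, opp; simpl.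
  apply Rabs_def1; lra. }
specialize (Hrho r B).
rewrite Derive_force_zero in Hrho by exact Hx0.
left; exact Hrho.
Qed.

End Hamiltonian.

(** With zero errors the right-hand side is [v^2 + kappa u^2], at least
    [2 c (u^2 + v^2)]; errors of relative size [c / 3] consume at most one
    half of that, because [(|u| + |v|)^2 <= 2 (u^2 + v^2)]. *)
Lemma increment_form_coercive (kappa u v dF dG dV : R) :
  0 < kappa ->
  let c := Rmin 1 kappa / 2 in
  Rabs dF <= c / 3 * (Rabs u + Rabs v) ->
  Rabs dG <= c / 3 * (Rabs u + Rabs v) ->
  Rabs (dV + kappa * u) <= c / 3 * Rabs u ->
  c * (u ^ 2 + v ^ 2) <= v * (v + dF) + u * (- dV + dG).
Proof.
intros Hk c HF HG HV.
assert (Hc : 0 < c) by (unfold c, Rmin; destruct Rle_dec; lra).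
assert (Hc1 : 2 * c <= 1) by (unfold c, Rmin; destruct Rle_dec; lra).
assert (Hck : 2 * c <= kappa) by (unfold c, Rmin; destruct Rle_dec; lra).
clearbody c.
assert (P : forall a b B, Rabs b <= B -> - (Rabs a * B) <= a * b).
{ intros a b B Hb.
  assert (Hab := Rabs_maj2 (a * b)); rewrite Rabs_mult in Hab.
  assert (Rabs a * Rabs b <= Rabs a * B)
    by (apply Rmult_le_compat_l; [apply Rabs_pos | exact Hb]).
  lra. }
assert (P1 := P v _ _ HF); assert (P2 := P u _ _ HG).
rewrite <- Rabs_Ropp in HV; assert (P3 := P u _ _ HV).
assert (Eu := pow2_abs u); assert (Ev := pow2_abs v).
assert (Q : 0 <= c * (Rabs u - Rabs v) ^ 2)
  by (apply Rmult_le_pos; [lra | apply pow2_ge_0]).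
assert (Q1 : 2 * c * v ^ 2 <= v ^ 2) by (assert (T := pow2_ge_0 v); nra).
assert (Q2 : 2 * c * u ^ 2 <= kappa * u ^ 2)
  by (assert (T := pow2_ge_0 u); nra).
assert (Q3 : 0 <= c * v ^ 2) by (assert (T := pow2_ge_0 v); nra).
assert (S : c * Rabs u ^ 2 = c * u ^ 2) by now rewrite Eu.
assert (S' : c * Rabs v ^ 2 = c * v ^ 2) by now rewrite Ev.
lra.
Qed.

Theorem theorem4
  (H : R -> R -> R -> R) (V : R -> R -> R) (w : R -> R) (d0 : R)
  (F G : R -> R -> R -> R) (Fk Gk : nat -> R -> R -> R) (q : nat)
  (H_smooth : smooth_on3 (fun _ _ _ => True) H)
  (F_smooth : smooth_on3 (fun _ _ t => 0 < t) F)
  (G_smooth : smooth_on3 (fun _ _ t => 0 < t) G)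
  (H_form : forall x y l : R, H x y l = y ^ 2 / 2 + V x l)
  (V_deriv : forall x l : R,
     is_derive (fun s => V s l) x ((x ^ 2 - l) * w x))
  (d0_pos : 0 < d0)
  (w_pos_nonneg : forall x l : R,
     0 <= l -> Rabs x < sqrt l + d0 -> 0 < w x)
  (w_pos_neg : forall x l : R, l < 0 -> Rabs x < d0 -> 0 < w x)
  (F_vanishes : vanishes_loc_unif F)
  (G_vanishes : vanishes_loc_unif G)
  (q_pos : (0 < q)%nat)
  (Fk_smooth : forall k : nat, (1 <= k)%nat -> smooth2 (Fk k))
  (Gk_smooth : forall k : nat, (1 <= k)%nat -> smooth2 (Gk k))
  (F_expansion : power_expansion_C1 q F Fk)
  (G_expansion : power_expansion_C1 q G Gk)
  (lam : R) (lam_pos : 0 < lam)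
  (n : nat) (n_bounds : (1 <= n <= q)%nat)
  (FG_low : forall i : nat, (1 <= i < n)%nat ->
     forall x y : R, Fk i x y = 0 /\ Gk i x y = 0)
  (t0 : R) (t0_pos : 0 < t0)
  (xs ys : R -> R) (xk yk : nat -> R)
  (sol : solution_from (rhs_x H F lam) (rhs_y H G lam) t0 xs ys)
  (xs_expansion : power_expansion q xs (- sqrt lam) xk)
  (ys_expansion : power_expansion q ys 0 yk) :
  lyapunov_unstable (rhs_x H F lam) (rhs_y H G lam) t0 xs ys.
Proof.
assert (Hq : 0 < sqrt lam) by now apply sqrt_lt_R0.
assert (Hsq : (- sqrt lam) ^ 2 = lam).
{ rewrite <- (pow2_sqrt lam) at 2 by lra; ring. }
assert (Hw : 0 < w (- sqrt lam)).
{ apply w_pos_nonneg with lam; [lra|].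
  rewrite Rabs_Ropp, Rabs_pos_eq; lra. }
set (kappa := 2 * sqrt lam * w (- sqrt lam)).
assert (Hk : 0 < kappa) by (unfold kappa; repeat apply Rmult_lt_0_compat; lra).
set (c := Rmin 1 kappa / 2).
assert (Hc : 0 < c) by (unfold c, Rmin; destruct Rle_dec; lra).
assert (Hc3 : 0 < c / 3) by lra.
set (eta := mkposreal _ Hc3).
destruct (saddle_increment H V w H_smooth H_form V_deriv _ lam eta Hsq)
  as [rho Hrho].
(* Both solutions stay in the square of half-side [M]: their distance to
   [(- sqrt lam, 0)] is less than [2 eps <= 1]. *)
set (M := sqrt lam + 1).
destruct (expansion_increment q F Fk M eta F_smooth F_expansion) as [TF HF].
destruct (expansion_increment q G Gk M eta G_smooth G_expansion) as [TG HG].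
assert (Hrho0 := cond_pos rho).
assert (He : 0 < Rmin 1 rho / 2) by (unfold Rmin; destruct Rle_dec; lra).
set (eps := mkposreal _ He).
assert (He1 : 2 * eps <= 1) by (simpl; unfold Rmin; destruct Rle_dec; lra).
assert (He2 : 2 * eps <= rho) by (simpl; unfold Rmin; destruct Rle_dec; lra).
destruct (proj2 (is_lim_spec _ _ _) (power_expansion_lim _ _ _ _ xs_expansion)
  eps) as [Tx Hx].
destruct (proj2 (is_lim_spec _ _ _) (power_expansion_lim _ _ _ _ ys_expansion)
  eps) as [Ty Hy].
clearbody eps.
set (s := Rmax t0 (Rmax (Rmax TF TG) (Rmax Tx Ty)) + 1).
assert (Hs : t0 < s /\ TF < s /\ TG < s /\ Tx < s /\ Ty < s).
{ assert (Hlt : Rmax t0 (Rmax (Rmax TF TG) (Rmax Tx Ty)) < s)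
    by (unfold s; lra).
  apply Rmax_Rlt in Hlt as [? Hlt]; apply Rmax_Rlt in Hlt as [Hl Hr].
  apply Rmax_Rlt in Hl; apply Rmax_Rlt in Hr; tauto. }
clearbody s.
apply product_expansion_unstable with s c eps; [exact sol | lra | exact Hc |].
intros t x y Ht Ux Uy.
specialize (Hx t ltac:(lra)); specialize (Hy t ltac:(lra)); simpl in Hx, Hy.
apply Rabs_def2 in Hx; apply Rabs_def2 in Hy.
apply Rabs_def2 in Ux; apply Rabs_def2 in Uy.
assert (Bx : Rabs x <= M) by (apply Rabs_le; unfold M; lra).
assert (By : Rabs y <= M) by (apply Rabs_le; unfold M; lra).
assert (Bxs : Rabs (xs t) <= M) by (apply Rabs_le; unfold M; lra).
assert (Bys : Rabs (ys t) <= M) by (apply Rabs_le; unfold M; lra).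
assert (IF := HF t ltac:(lra) x y (xs t) (ys t) Bx By Bxs Bys).
assert (IG := HG t ltac:(lra) x y (xs t) (ys t) Bx By Bxs Bys).
assert (IV := Hrho x (xs t) ltac:(apply Rabs_le; lra)
  ltac:(apply Rabs_le; lra)).
replace (_ - 2 * - sqrt lam * w (- sqrt lam) * (x - xs t)) with
  ((x ^ 2 - lam) * w x - (xs t ^ 2 - lam) * w (xs t) + kappa * (x - xs t))
  in IV by (unfold kappa; ring).
assert (K := increment_form_coercive _ _ _ _ _ _ Hk IF IG IV).
apply Rle_trans with (1 := K); right.
unfold rhs_x, rhs_y.
rewrite !(partial1_H H V w H_form V_deriv), !(partial2_H H V H_form).
ring.
Qed.
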